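(* There are absolute constants $C_1,C_2,C_3,C_4$ such that the following holds. Let $\Phi_1,\dots,\Phi_m$ be i.i.d. copies of a random matrix $\Phi\in\mathbb{R}^{n\times n}$ satisfying: (1) $E[\Phi]=0$; (2) there is a constant $\alpha>0$ such that $\alpha\le E[|\langle\Phi,U\rangle|]$ for all $U\in\mathbb{R}^{n\times n}$ with $|U|_F=1$; (3) there is a constant $\sigma>0$ such that $P[|\langle\Phi,U\rangle|\ge\tau]\le2\exp(-\tau^2/2\sigma^2)$ for all $\tau>0$ and all $U$ with $|U|_F=1$. Set $\rho:=\sigma/\alpha$. Let $X\in\Sigma_s^{n\times n}$ be a columnwise $s$-sparse and $l_1$-column-flat signal, let $y\in\mathbb{R}^m$ with $y_k=\langle\Phi_k,X\rangle+e_k$, $k=1,\dots,m$, where $|e|_2\le\eta$, and let $X^*$ be the minimizer of $$\inf|||Z|||_1\quad\text{s.t. }Z\in\mathbb{R}^{n\times n},\ \big|y-(\langle\Phi_k,Z\rangle)_{k=1}^m\big|_2\le\eta.$$ Let $t>0$ and $\delta>0$. If $$m\ge\frac{C_1\rho^4}{\alpha}\Big(\alpha t+\frac{2\eta}{\delta}+\sigma C_2\big(\rho^6ns\log(C_3n^6)\big)^{1/2}\Big)^2,$$ then $$P\big[|X^*-X|_F\le\delta\big]\ge1-\exp(-C_4t^2).$$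
   Context: For $Z=(z_1,\dots,z_n)\in\mathbb{R}^{n\times n}$ with columns $z_j$, $|||Z|||_1:=\max_j|z_j|_1$ ($|\cdot|_1$ the vector $l_1$-norm). $\Sigma_s^{n\times n}$ is the set of $n\times n$ real matrices each of whose columns has at most $s$ nonzero entries. $X$ is $l_1$-column-flat if all its columns have the same $l_1$-norm. $\langle X,Y\rangle=\mathrm{tr}(X^TY)$, $|\cdot|_F$ is the Frobenius norm, $|\cdot|_2$ the Euclidean norm. Throughout the paper it is assumed that $0\le\eta<|y|_2$ in this problem.
   Formalization: The sample-size condition is proved with the factor C_1ρ^4/α^2 in place of the printed C_1ρ^4/α; the printed form is false, since rescaling Φ, e and η by a small common factor makes it hold already for m=1. *)

(* Defs.v *)
From HB Require Import structures.
From mathcomp Require Import all_boot all_order all_algebra.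
From mathcomp Require Import all_classical all_reals all_analysis.

Set Implicit Arguments.
Unset Strict Implicit.
Unset Printing Implicit Defensive.

Import Order.TTheory GRing.Theory Num.Theory.
Import numFieldNormedType.Exports.

Local Open Scope classical_set_scope.
Local Open Scope ring_scope.

Section Norms.
Variable R : realType.

Definition l1norm (n : nat) (v : 'cV[R]_n) : R := \sum_(i < n) `|v i 0|.

Definition l2norm (n : nat) (v : 'cV[R]_n) : R :=
  Num.sqrt (\sum_(i < n) v i 0 ^+ 2).

Definition mxdot (n : nat) (A B : 'M[R]_n) : R := \tr (A^T *m B).

Definition frobnorm (n : nat) (A : 'M[R]_n) : R :=
  Num.sqrt (\sum_(i < n) \sum_(j < n) A i j ^+ 2).

Definition maxcol_l1norm (n : nat) (Z : 'M[R]_n) : R :=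
  \big[Num.max/0]_(j < n) l1norm (col j Z).

Definition col_sparse (s n : nat) (X : 'M[R]_n) : Prop :=
  forall j : 'I_n, (#|[set i : 'I_n | X i j != 0%R]%SET| <= s)%N.

Definition l1_col_flat (n : nat) (X : 'M[R]_n) : Prop :=
  forall j k : 'I_n, l1norm (col j X) = l1norm (col k X).

Definition measurement (m n : nat) (A : 'I_m -> 'M[R]_n) (Z : 'M[R]_n) :
  'cV[R]_m := \col_k mxdot (A k) Z.

Definition feasible (m n : nat) (A : 'I_m -> 'M[R]_n) (y : 'cV[R]_m) (eta : R)
  (Z : 'M[R]_n) : Prop := l2norm (y - measurement A Z) <= eta.

Definition is_minimizer (m n : nat) (A : 'I_m -> 'M[R]_n) (y : 'cV[R]_m)
    (eta : R) (Z : 'M[R]_n) : Prop :=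
  feasible A y eta Z /\
  forall Z' : 'M[R]_n, feasible A y eta Z' ->
    maxcol_l1norm Z <= maxcol_l1norm Z'.

End Norms.

(* 'M[R]_(m, n) with its Borel sigma-algebra, so that a random matrix (or a
   random vector, when n = 1) is an element of {RV P >-> borel_mx R m n}. *)
Definition borel_mx (R : realType) (m n : nat) :=
  g_sigma_algebraType [set A : set 'M[R]_(m, n) | open A].

Section Random.
Variable R : realType.

Definition equal_in_law d1 d2 d' (T1 : measurableType d1)
    (T2 : measurableType d2) (T' : measurableType d')
    (P1 : probability T1 R) (P2 : probability T2 R)
    (V : {RV P1 >-> T'}) (W : {RV P2 >-> T'}) : Prop :=
  forall A : set T', measurable A -> distribution P1 V A = distribution P2 W A.

(* Subfamilies are covered by taking B k = setT for the remaining indices. *)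
Definition mutually_independent d d' (T : measurableType d)
    (T' : measurableType d') (P : probability T R) (m : nat)
    (V : 'I_m -> {RV P >-> T'}) : Prop :=
  forall B : 'I_m -> set T', (forall k, measurable (B k)) ->
    P [set w | forall k, B k (V k w)] =
    (\prod_(k < m) P (V k @^-1` B k))%E.

Definition iid_copies d0 d d' (T0 : measurableType d0) (T : measurableType d)
    (T' : measurableType d') (P0 : probability T0 R) (P : probability T R)
    (V0 : {RV P0 >-> T'}) (m : nat) (V : 'I_m -> {RV P >-> T'}) : Prop :=
  mutually_independent V /\ forall k, equal_in_law (V k) V0.

End Random.

(* Main.v *)
(** Flatness makes the error H = X* - X satisfy, column by column, the cone condition of vector
    l1-minimization, hence |H|_1 <= 2 sqrt(ns) |H|_F for the entrywise l1-norm.  It remains to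
    bound (1/m) \sum_k |<Phi_k, H>| from below by (alpha / 8) |H|_F on that cone.  For a single
    matrix V the Laplace transform of |<Phi, V>| gives the bound (alpha / 2) |V|_F outside an
    event of probability exp(- c m / rho^2).  By Maurey's empirical method H / |H|_1 is close to
    an average of L ~ rho^2 n s signed unit matrices, both for the squared Frobenius norm and for
    the form (1/m) \sum_k <Phi_k, .>^2, because the latter is at most 60 sigma^2 at all unit
    matrices with high probability; a union bound over the (2 n^2)^L such averages is therefore enough,
    and no symmetrization or chaining is needed. *)
Require Import Defs.
From mathcomp Require Import all_boot all_order all_algebra.
From mathcomp Require Import all_classical all_reals all_analysis.
From mathcomp Require Import measurable_realfun.
From mathcomp Require Import ring lra.

Import Order.TTheory GRing.Theory Num.Theory.
Import numFieldNormedType.Exports.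

Local Open Scope classical_set_scope.
Local Open Scope ring_scope.

(** * Maurey's empirical method and Cauchy-Schwarz for finite sums *)

Lemma exists_le_weighted_mean {R : realDomainType} (A : finType) (p F : A -> R) :
  (forall a, 0 <= p a) -> \sum_a p a = 1 ->
  exists a, F a <= \sum_b p b * F b.
Proof.
move=> p0 p1; have [a0 _|noA] := pickP (fun _ : A => true); last first.
  by move: p1; rewrite big_pred0// => /esym/eqP; rewrite oner_eq0.
exists [arg min_(a < a0) F a]%O; case: arg_minP => // a _ aF.
rewrite -[leLHS]mul1r -p1 mulr_suml; apply: ler_sum => b _.
by rewrite ler_wpM2l// aF.
Qed.

(* The tuple is chosen greedily: replacing the next atom by its mean kills the cross term, so
   some atom increases the weighted squared error by at most [c]. *)
Lemma maurey {R : realDomainType} (A D : finType) (q : D -> R) (x : A -> D -> R)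
    (p : A -> R) (c : R) (L : nat) :
  (forall d, 0 <= q d) -> (forall a, 0 <= p a) -> \sum_a p a = 1 ->
  (forall a, \sum_d q d * x a d ^+ 2 <= c) ->
  exists t : L.-tuple A,
    \sum_d q d * (\sum_(a <- t) x a d - L%:R * \sum_a p a * x a d) ^+ 2
      <= L%:R * c.
Proof.
move=> q0 p0 p1 xc; pose mu d := \sum_a p a * x a d.
elim: L => [|L [t tL]].
  by exists [tuple]; rewrite mul0r big1// => d _; rewrite big_nil mul0r subrr expr0n mulr0.
pose W d := \sum_(a <- t) x a d - L%:R * mu d.
pose F a := \sum_d q d * (W d + (x a d - mu d)) ^+ 2.
have [a Fa] := exists_le_weighted_mean _ _ F p0 p1.
exists [tuple of a :: t]; rewrite [leLHS](_ : _ = F a); last first.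
  apply: eq_bigr => d _; rewrite big_cons /W -natr1 -/(mu d); congr (_ * _ ^+ 2); ring.
apply: (le_trans Fa); rewrite -natr1 mulrDl mul1r.
(* Bias-variance decomposition: the mean of [F] is the old error plus the variance of one atom, and
   a variance is at most the second moment, hence at most [c]. *)
suff -> : \sum_b p b * F b = \sum_d q d * W d ^+ 2
    + (\sum_b p b * (\sum_d q d * x b d ^+ 2) - \sum_d q d * mu d ^+ 2).
  apply: lerD; first exact: tL.
  rewrite lerBlDr ler_wpDr//; first by apply: sumr_ge0 => d _; rewrite mulr_ge0 ?q0 ?sqr_ge0.
  rewrite -[leRHS]mul1r -p1 mulr_suml; apply: ler_sum => b _.
  by rewrite ler_wpM2l.
under eq_bigr do rewrite mulr_sumr.
have -> : \sum_b p b * (\sum_d q d * x b d ^+ 2) = \sum_d \sum_b p b * (q d * x b d ^+ 2).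
  by rewrite exchange_big; apply: eq_bigr => b _; rewrite mulr_sumr.
rewrite exchange_big/=.
rewrite -sumrB -big_split/=; apply: eq_bigr => d _.
transitivity (q d * ((W d - mu d) ^+ 2 * \sum_a p a + 2 * (W d - mu d) * mu d
    + \sum_a p a * x a d ^+ 2)).
  rewrite /mu !mulr_sumr -!big_split/= mulr_sumr; apply: eq_bigr => b _; ring.
rewrite p1; have -> : \sum_a p a * (q d * x a d ^+ 2) = q d * \sum_a p a * x a d ^+ 2.
  by rewrite mulr_sumr; apply: eq_bigr => b _; ring.
ring.
Qed.

(* Cauchy-Schwarz, by AM-GM on each term so that no square root of [N] is needed. *)
Lemma sum_norm_le {R : realFieldType} (I : finType) (Q : pred I) (e : I -> R) (N r : R) :
  0 < r -> #|Q|%:R <= N -> \sum_(i | Q i) e i ^+ 2 <= N * r ^+ 2 ->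
  \sum_(i | Q i) `|e i| <= N * r.
Proof.
move=> r0 QN eN.
have H i : `|e i| <= (2 * r)^-1 * e i ^+ 2 + r / 2.
  rewrite -(ler_pM2l (_ : 0 < 2 * r)) ?mulr_gt0//.
  rewrite mulrDr mulrA divff ?mul1r; last by rewrite mulf_neq0// gt_eqF.
  have -> : 2 * r * (r / 2) = r ^+ 2 by field.
  rewrite -(real_normK (num_real (e i))); have := sqr_ge0 (`|e i| - r); nra.
apply: (le_trans (ler_sum _ (fun i _ => H i))).
rewrite big_split/= -mulr_sumr sumr_const -[in leLHS]mulr_natr.
have r20 : 0 < (2 * r)^-1 by rewrite invr_gt0 mulr_gt0.
have := ler_wpM2l (ltW r20) eN; have -> : (2 * r)^-1 * (N * r ^+ 2) = N * r / 2.
  by field; rewrite gt_eqF.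
move=> h1; have : r / 2 * #|Q|%:R <= r / 2 * N by rewrite ler_wpM2l// divr_ge0// ltW.
lra.
Qed.

(** * Matrix norms, and the passage from the net to the cone *)

Section MatrixNorms.
Context {R : realType} {n : nat}.
Implicit Types A B : 'M[R]_n.

Lemma mxdotE A B : mxdot A B = \sum_i \sum_j A i j * B i j.
Proof.
rewrite /mxdot /mxtrace exchange_big/=; apply: eq_bigr => j _.
by rewrite mxE; apply: eq_bigr => i _; rewrite mxE.
Qed.

Lemma mxdotDr A B C : mxdot A (B + C) = mxdot A B + mxdot A C.
Proof. by rewrite /mxdot mulmxDr raddfD. Qed.

Lemma mxdotBr A B C : mxdot A (B - C) = mxdot A B - mxdot A C.
Proof. by rewrite /mxdot mulmxBr raddfB. Qed.

Lemma mxdotZr A (c : R) B : mxdot A (c *: B) = c * mxdot A B.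
Proof. by rewrite /mxdot -scalemxAr linearZ. Qed.

Lemma mxdot_sumr A (I : Type) (r : seq I) (F : I -> 'M[R]_n) :
  mxdot A (\sum_(i <- r) F i) = \sum_(i <- r) mxdot A (F i).
Proof. by rewrite /mxdot mulmx_sumr raddf_sum. Qed.

Lemma mxdot_delta A i j : mxdot A (delta_mx i j) = A i j.
Proof.
rewrite mxdotE (bigD1 i)//= (bigD1 j)//= mxE !eqxx mulr1 big1 ?addr0; last first.
  by move=> k /negbTE jk; rewrite mxE jk andbF mulr0.
rewrite big1 ?addr0// => k /negbTE ik; rewrite big1// => l _.
by rewrite mxE ik mulr0.
Qed.

Lemma frobnorm_ge0 A : 0 <= frobnorm A.
Proof. exact: sqrtr_ge0. Qed.

Lemma frobnorm_sqr A : frobnorm A ^+ 2 = \sum_i \sum_j A i j ^+ 2.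
Proof. by rewrite sqr_sqrtr// sumr_ge0// => i _; rewrite sumr_ge0// => j _; rewrite sqr_ge0. Qed.

Lemma frobnormZ (c : R) A : frobnorm (c *: A) = `|c| * frobnorm A.
Proof.
rewrite /frobnorm -sqrtr_sqr -sqrtrM ?sqr_ge0//; congr Num.sqrt.
rewrite mulr_sumr; apply: eq_bigr => i _; rewrite mulr_sumr; apply: eq_bigr => j _.
by rewrite mxE exprMn.
Qed.

Lemma frobnorm_delta i j : frobnorm (delta_mx i j : 'M[R]_n) = 1.
Proof.
have -> : frobnorm (delta_mx i j : 'M[R]_n) = Num.sqrt (mxdot (delta_mx i j) (delta_mx i j)).
  by rewrite mxdotE /frobnorm; congr Num.sqrt; apply: eq_bigr => k _; apply: eq_bigr.
by rewrite mxdot_delta mxE !eqxx sqrtr1.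
Qed.

Definition entry_l1norm A : R := \sum_i \sum_j `|A i j|.

Lemma entry_l1norm_eq0 A : (entry_l1norm A == 0) = (A == 0).
Proof.
apply/idP/eqP => [|->]; last first.
  by apply/eqP; rewrite /entry_l1norm big1// => i _; rewrite big1// => j _; rewrite mxE normr0.
rewrite /entry_l1norm psumr_eq0; last by move=> i _; exact: sumr_ge0.
move=> /allP A0; apply/matrixP => i j; rewrite mxE.
have := A0 i (mem_index_enum _); rewrite /= psumr_eq0// => /allP/(_ j (mem_index_enum _)).
by rewrite /= normr_eq0 => /eqP.
Qed.

Lemma frobnorm_eq0 A : frobnorm A = 0 -> A = 0.
Proof.
move=> A0; have : \sum_i \sum_j A i j ^+ 2 = 0 by rewrite -frobnorm_sqr A0 expr0n.
move/eqP; rewrite psumr_eq0; last by move=> i _; apply: sumr_ge0 => j _; exact: sqr_ge0.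
move=> /allP H; apply/matrixP => i j; rewrite mxE.
have := H i (mem_index_enum _); rewrite /= psumr_eq0; last by move=> k _; exact: sqr_ge0.
by move=> /allP/(_ j (mem_index_enum _)); rewrite /= sqrf_eq0 => /eqP.
Qed.

Lemma frobnorm0 : frobnorm (0 : 'M[R]_n) = 0.
Proof.
by rewrite -(scale0r (0 : 'M[R]_n)) frobnormZ normr0 mul0r.
Qed.

(** The extreme points of the entrywise l1 unit ball; the bit [true] stands for the sign -1. *)
Definition signed_unit (a : 'I_n * 'I_n * bool) : 'M[R]_n :=
  (-1) ^+ a.2 *: delta_mx a.1.1 a.1.2.

(** A sum rather than an average: the lower bound is homogeneous, so the division by [L] can be
    omitted. *)
Definition net_point (L : nat) (t : L.-tuple ('I_n * 'I_n * bool)) : 'M[R]_n :=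
  \sum_(a <- t) signed_unit a.

(** Maurey's method yields a net point [V] near [L W], where [W = H / |H|_1]. On the cone
    [|W|_F^2 >= 1 / beta], so the first condition on [L] gives [|V|_F >= |L W|_F / 2], and the
    second bounds the measurements of [V - L W] by [alpha / 8 |L W|_F] on average. Of the
    [alpha / 4] that the net provides, [alpha / 8] remains. *)
Lemma net_lower_bound (m L : nat) (A : 'I_m -> 'M[R]_n) (alpha tau beta : R) :
  0 < alpha -> 0 < tau ->
  8 * beta <= L%:R -> 128 * tau * beta <= L%:R * alpha ^+ 2 ->
  (forall i j, \sum_k A k i j ^+ 2 <= m%:R * tau) ->
  (forall t : L.-tuple ('I_n * 'I_n * bool),
    m%:R * (alpha / 2 * frobnorm (net_point L t))
      <= \sum_k `|mxdot (A k) (net_point L t)|) ->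
  forall H : 'M[R]_n, entry_l1norm H ^+ 2 <= beta * frobnorm H ^+ 2 ->
    m%:R * (alpha / 8 * frobnorm H) <= \sum_k `|mxdot (A k) H|.
Proof.
move=> a0 tau0 Lb Lt Atau netA H HB.
have [->|Hn0] := eqVneq H 0.
  by rewrite frobnorm0 !mulr0 sumr_ge0.
have [m0|mpos] := posnP m.
  by rewrite [m in m%:R]m0 mul0r sumr_ge0.
have m0 : 0 < m%:R :> R by rewrite ltr0n.
set h := entry_l1norm H in HB.
have h0 : 0 < h.
  rewrite lt_def entry_l1norm_eq0 Hn0/= /h /entry_l1norm.
  by apply: sumr_ge0 => i _; exact: sumr_ge0.
set f := frobnorm H in HB *.
have f0 : 0 < f.
  by rewrite lt_def frobnorm_ge0 andbT; apply: contra_neq Hn0; exact: frobnorm_eq0.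
pose W : 'M[R]_n := h^-1 *: H.
(* Weights that make [W] the mean of the signed units: each position carries mass [|H i j| / h],
   placed on the sign of its entry. *)
pose p (a : 'I_n * 'I_n * bool) := 
  if a.2 == (H a.1.1 a.1.2 < 0) then h^-1 * `|H a.1.1 a.1.2| else 0.
(* Maurey's method is run in the Euclidean space of entries and measurements together, the
   latter weighted so that every signed unit has squared norm at most 2. *)
pose q (d : ('I_n * 'I_n) + 'I_m) := if d is inr _ then (m%:R * tau)^-1 else 1 : R.
pose x a (d : ('I_n * 'I_n) + 'I_m) :=
  match d with inl ij => signed_unit a ij.1 ij.2 | inr k => mxdot (A k) (signed_unit a) end.
have sum_idx (F : 'I_n * 'I_n * bool -> R) :
    \sum_a F a = \sum_i \sum_j \sum_b F (i, j, b).
  by rewrite pair_big pair_big; apply: eq_bigr => -[[i j] b].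
have sum_p (F : 'I_n * 'I_n * bool -> R) :
    \sum_a p a * F a = \sum_i \sum_j h^-1 * `|H i j| * F (i, j, H i j < 0).
  rewrite sum_idx; apply: eq_bigr => i _; apply: eq_bigr => j _.
  rewrite (bigD1 (H i j < 0))//= big1 ?addr0; last first.
    by move=> b /negbTE bH; rewrite /p /= bH mul0r.
  by rewrite /p/= eqxx.
have meanE : \sum_a p a *: signed_unit a = W.
  apply/matrixP => k l; rewrite summxE.
  under eq_bigr do rewrite mxE.
  rewrite (sum_p (fun a => signed_unit a k l)) /W mxE.
  transitivity (\sum_i \sum_j h^-1 * (H i j * (delta_mx k l : 'M[R]_n) i j)).
    apply: eq_bigr => i _; apply: eq_bigr => j _; rewrite -mulrA; congr (_ * _).
    by rewrite !mxE/= mulrA [`|_| * _]mulrC -numEsign eq_sym [l == _]eq_sym.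
  under eq_bigr do rewrite -mulr_sumr.
  by rewrite -mulr_sumr -mxdotE mxdot_delta.
have q0 d : 0 <= q d by case: d => //= k; rewrite invr_ge0 mulr_ge0// ltW.
have p0 a : 0 <= p a by rewrite /p; case: ifP => // _; rewrite mulr_ge0// invr_ge0 ltW.
have p1 : \sum_a p a = 1.
  under eq_bigr do rewrite -[p _]mulr1.
  rewrite (sum_p (fun=> 1)).
  under eq_bigr do (under eq_bigr do rewrite mulr1; rewrite -mulr_sumr).
  by rewrite -mulr_sumr mulVf// gt_eqF.
have x2 a : \sum_d q d * x a d ^+ 2 <= 2.
  rewrite big_sumType/= -[2]/(1 + 1); apply: lerD.
    under eq_bigr do rewrite mul1r.
    rewrite -(pair_bigA _ (fun i j => signed_unit a i j ^+ 2))/= -frobnorm_sqr.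
    by rewrite frobnormZ normrX normrN1 expr1n mul1r frobnorm_delta expr1n.
  rewrite -mulr_sumr mulrC ler_pdivrMr ?mulr_gt0// mul1r.
  under eq_bigr do rewrite mxdotZr mxdot_delta exprMn sqrr_sign mul1r.
  exact: Atau.
have [t] := maurey _ _ _ _ _ _ L q0 p0 p1 x2.
set V := net_point L t; rewrite big_sumType/=.
under eq_bigr do rewrite mul1r.
have -> : \sum_(ij : 'I_n * 'I_n) (\sum_(a <- t) signed_unit a ij.1 ij.2 -
    L%:R * (\sum_a p a * signed_unit a ij.1 ij.2)) ^+ 2 = frobnorm (V - L%:R *: W) ^+ 2.
  rewrite frobnorm_sqr pair_bigA/=; apply: eq_bigr => -[i j] _ /=.
  rewrite mxE [(- (L%:R *: W)) i j]mxE [(L%:R *: W) i j]mxE -meanE /V /net_point !summxE.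
  by congr ((_ - _ * _) ^+ 2); apply: eq_bigr => a _; rewrite [RHS]mxE.
have -> : \sum_k (m%:R * tau)^-1 * (\sum_(a <- t) mxdot (A k) (signed_unit a) -
     L%:R * (\sum_a p a * mxdot (A k) (signed_unit a))) ^+ 2 =
    (m%:R * tau)^-1 * \sum_k (mxdot (A k) (V - L%:R *: W)) ^+ 2.
  rewrite mulr_sumr; apply: eq_bigr => k _.
  rewrite mxdotBr mxdot_sumr mxdotZr -meanE mxdot_sumr; congr (_ * (_ - _ * _) ^+ 2).
  by apply: eq_bigr => a _; rewrite [RHS]mxdotZr.
set E2 := \sum_k _ ^+ 2 => tL.
have E20 : 0 <= E2 by apply: sumr_ge0 => k _; exact: sqr_ge0.
have mt0 : 0 < m%:R * tau by rewrite mulr_gt0.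
have VW2 : frobnorm (V - L%:R *: W) ^+ 2 <= L%:R * 2.
  by apply: le_trans tL; rewrite lerDl mulr_ge0// invr_ge0 ltW.
have E2L : E2 <= L%:R * 2 * (m%:R * tau).
  rewrite -ler_pdivrMr// mulrC; apply: le_trans tL.
  by rewrite lerDr sqr_ge0.
pose g := f / h.
have g0 : 0 < g by rewrite divr_gt0.
have gf : g * h = f by rewrite /g divfK// gt_eqF.
have WE : frobnorm (L%:R *: W) = L%:R * g.
  rewrite !frobnormZ ger0_norm// gtr0_norm ?invr_gt0// -/f /g; ring.
have bg : 1 <= beta * g ^+ 2.
  move: HB; rewrite -gf exprMn mulrA -[leLHS]mul1r ler_pM2r ?exprn_gt0//.
have Lg8 : 8 <= L%:R * g ^+ 2.
  by have := ler_wpM2r (sqr_ge0 g) Lb; lra.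
have L0 : 0 < L%:R :> R.
  by rewrite lt_def ler0n andbT; apply: contraTneq Lg8 => ->; rewrite mul0r -ltNge ltr0n.
have Lg128 : 128 * tau <= L%:R * alpha ^+ 2 * g ^+ 2.
  have := ler_wpM2r (sqr_ge0 g) Lt; have := ler_wpM2l (ltW tau0) bg; lra.
(* Entrywise [a^2 <= 2 v^2 + 2 (v - a)^2]; the error term takes at most half of [(L g)^2], because
   [L g^2 >= 8]. *)
have V2 : (L%:R * g / 2) ^+ 2 <= frobnorm V ^+ 2.
  have : frobnorm (L%:R *: W) ^+ 2 <= 2 * frobnorm V ^+ 2 + 2 * frobnorm (V - L%:R *: W) ^+ 2.
    rewrite !frobnorm_sqr !mulr_sumr -big_split/=; apply: ler_sum => i _.
    rewrite !mulr_sumr -big_split/=; apply: ler_sum => j _.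
    have -> : (V - L%:R *: W) i j = V i j - (L%:R *: W) i j.
      by rewrite [LHS]mxE; congr (_ + _); rewrite mxE.
    have := sqr_ge0 (2 * V i j - (L%:R *: W) i j); nra.
  rewrite WE; have : L%:R * 2 <= (L%:R * g) ^+ 2 / 4; last by nra.
  rewrite ler_pdivlMr// exprMn expr2 -mulrA -[leLHS]mulrA ler_pM2l//; lra.
have VL : L%:R * g / 2 <= frobnorm V.
  by move: V2; rewrite ler_sqr// nnegrE ?frobnorm_ge0// divr_ge0// mulr_ge0// ltW.
have r0 : 0 < alpha / 8 * (L%:R * g) by rewrite mulr_gt0 ?divr_gt0// mulr_gt0.
have err : \sum_k `|mxdot (A k) (V - L%:R *: W)| <= m%:R * (alpha / 8 * (L%:R * g)).
  apply: sum_norm_le => //; first by rewrite card_ord.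
  apply: (le_trans E2L); rewrite mulrCA ler_pM2l//.
  have := ler_wpM2l (ltW L0) Lg128; nra.
have tri : \sum_k `|mxdot (A k) V| <=
    \sum_k `|mxdot (A k) (V - L%:R *: W)| + \sum_k `|mxdot (A k) (L%:R *: W)|.
  rewrite -big_split/=; apply: ler_sum => k _.
  have -> : mxdot (A k) V = mxdot (A k) (V - L%:R *: W) + mxdot (A k) (L%:R *: W).
    by rewrite -mxdotDr subrK.
  exact: ler_normD.
have WH : \sum_k `|mxdot (A k) (L%:R *: W)| = L%:R / h * \sum_k `|mxdot (A k) H|.
  rewrite mulr_sumr; apply: eq_bigr => k _.
  by rewrite /W scalerA mxdotZr normrM gtr0_norm// divr_gt0.
have := netA t; rewrite -/V => nV.
have aV : m%:R * (alpha / 2 * (L%:R * g / 2)) <= m%:R * (alpha / 2 * frobnorm V).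
  by rewrite ler_pM2l// ler_pM2l// divr_gt0.
rewrite -(ler_pM2l (_ : 0 < L%:R / h)) ?divr_gt0// -WH.
have -> : L%:R / h * (m%:R * (alpha / 8 * f)) = m%:R * (alpha / 8 * (L%:R * g)).
  by rewrite /g; ring.
lra.
Qed.

End MatrixNorms.

(** * Expectations of products of independent variables, and Chernoff's bound *)

Section Independence.
Import HBNNSimple.

(** The hypothesis on the sets [B] says that [nu] is the image under [V] of the measure with density
    [G]. The formula extends to simple functions by linearity and to [f] by monotone convergence. *)
Lemma ge0_integral_mulr_comp d d' (T : measurableType d) (T' : measurableType d')
    (R : realType) (mu : {measure set T -> \bar R}) (nu : {measure set T' -> \bar R})
    (V : {mfun T >-> T'}) (G : T -> R) (f : T' -> \bar R) :
  measurable_fun setT G -> (forall w, 0 <= G w) ->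
  (forall B, measurable B -> \int[mu]_w ((G w)%:E * (\1_B (V w))%:E) = nu B)%E ->
  measurable_fun setT f -> (forall z, 0 <= f z)%E ->
  (\int[mu]_w ((G w)%:E * f (V w)) = \int[nu]_z f z)%E.
Proof.
move=> mG G0 GB mf f0.
pose h := nnsfun_approx measurableT mf.
have hf z : ((h n z)%:E @[n --> \oo] --> f z)%classic by exact: cvg_nnsfun_approx.
have ndh z : {homo (fun n => (h n z)%:E) : n m / (n <= m)%N >-> (n <= m)%E}.
  by move=> n m nm; rewrite lee_fin; exact/lefP/nd_nnsfun_approx.
have mGE : measurable_fun setT (EFin \o G) by exact/measurable_EFinP.
have mVh n : measurable_fun setT (fun w => (h n (V w))%:E).
  by apply/measurable_EFinP; exact: measurableT_comp.
transitivity (limn (fun n => \int[mu]_w ((G w)%:E * (h n (V w))%:E)))%E.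
  rewrite -monotone_convergence//.
  - apply: eq_integral => w _; apply/esym/cvg_lim => //.
    exact: cvgeZl.
  - by move=> n; exact: emeasurable_funM.
  - by move=> n w _; rewrite mule_ge0// lee_fin.
  - by move=> w _ n m nm; apply: lee_wpmul2l; [rewrite lee_fin|exact: ndh].
transitivity (limn (fun n => \int[nu]_z (h n z)%:E))%E; last first.
  rewrite -monotone_convergence//.
  - by apply: eq_integral => z _; exact/cvg_lim.
  - by move=> n; exact/measurable_EFinP.
  - by move=> n z _; rewrite lee_fin.
congr (limn _); apply/funext => n.
have mr r : measurable (h n @^-1` [set r]) by exact: measurable_sfunP.
have mI r : measurable_fun setT (fun w => (\1_(h n @^-1` [set r]) (V w))%:E : \bar R).
  by apply/measurable_EFinP; exact: (measurableT_comp (measurable_indic (mr r))).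
transitivity (\sum_(r \in range (h n))
    \int[mu]_w (r%:E * ((G w)%:E * (\1_(h n @^-1` [set r]) (V w))%:E)))%E.
  rewrite -ge0_integral_fsum//.
  - apply: eq_integral => w _; rewrite fimfunE -fsumEFin// ge0_mule_fsumr; last first.
      by move=> r; rewrite EFinM nnfun_muleindic_ge0.
    by apply: eq_fsbigr => r _; rewrite EFinM muleCA.
  - by move=> r; apply: emeasurable_funM => //; exact: emeasurable_funM.
  - move=> r w _; rewrite muleCA; apply: mule_ge0; first by rewrite lee_fin.
    by rewrite nnfun_muleindic_ge0.
transitivity (\sum_(r \in range (h n)) \int[nu]_z (r * \1_(h n @^-1` [set r]) z)%:E)%E; last first.
  rewrite -ge0_integral_fsum//.
  - by apply: eq_integral => z _; rewrite fimfunE -fsumEFin.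
  - by move=> r; exact/measurable_EFinP/measurable_funM.
  - by move=> r z _; rewrite EFinM nnfun_muleindic_ge0.
apply: eq_fsbigr => r; rewrite inE => -[z _ <-].
rewrite ge0_integralZl//.
- by rewrite GB// integralZl_indic_nnsfun// integral_indic// setIT.
- exact: emeasurable_funM.
- by move=> w _; rewrite mule_ge0// lee_fin.
- by rewrite lee_fin.
Qed.

(** For indicators the claim is [mutually_independent] itself. The factors are then freed one at a
    time: weighting by the product of the others turns the law of the freed variable into a multiple
    of itself, and finite expectations make that multiple a real number. *)
Lemma ge0_integral_prod_indep d d' (T : measurableType d) (T' : measurableType d')
    (R : realType) (P : probability T R) (m : nat) (V : 'I_m -> {RV P >-> T'})
    (f : 'I_m -> T' -> R) :
  mutually_independent V ->
  (forall k, measurable_fun setT (f k)) -> (forall k z, 0 <= f k z) ->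
  (forall k, \int[P]_w (f k (V k w))%:E < +oo)%E ->
  (\int[P]_w (\prod_k f k (V k w))%:E = \prod_k \int[P]_w (f k (V k w))%:E)%E.
Proof.
move=> indep mf f0 foo.
have int1 (A : set T) : measurable A -> (P A = \int[P]_w (\1_A w)%:E)%E.
  by move=> mA; rewrite integral_indic// setIT.
(* Induction on the number [j] of factors that are not yet indicator functions. *)
suff H j : (j <= m)%N -> forall f : 'I_m -> T' -> R,
    (forall k, measurable_fun setT (f k)) -> (forall k z, 0 <= f k z) ->
    (forall k, \int[P]_w (f k (V k w))%:E < +oo)%E ->
    (forall k : 'I_m, (j <= k)%N -> exists2 B, measurable B & f k = \1_B) ->
    (\int[P]_w (\prod_k f k (V k w))%:E = \prod_k \int[P]_w (f k (V k w))%:E)%E.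
  by apply: (H m) => // k; rewrite leqNgt ltn_ord.
elim: j => [_|j IH jm] {mf f0 foo}f mf f0 foo ind.
  have /choice[B HB] (k : 'I_m) : exists B, measurable B /\ f k = \1_B.
    by have [B mB fB] := ind k isT; exists B.
  have mB k := (HB k).1; have fB k := (HB k).2.
  transitivity (P [set w | forall k, B k (V k w)]).
    have mA : measurable [set w | forall k, B k (V k w)].
      rewrite (_ : [set _ | _] = \bigcap_(k in setT) (V k @^-1` B k)).
        by apply: fin_bigcap_measurable => // k _; exact: measurable_funPTI.
      by apply/seteqP; split => w /= Bw k; [move=> _|]; exact: Bw.
    rewrite int1//; apply: eq_integral => w _; congr EFin.
    rewrite indicE; case: (boolP (w \in _)) => [/set_mem/= wB|/negP wB].
      by rewrite big1// => k _; rewrite fB indicE mem_set.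
    have [k kB] : exists k, ~ B k (V k w).
      by apply/existsNP => wB'; apply: wB; rewrite inE.
    by rewrite (bigD1 k)//= fB indicE memNset// mul0r.
  rewrite indep//; apply: eq_bigr => k _.
  by rewrite fB int1//; exact: measurable_funPTI.
pose j' := Ordinal jm.
pose G w := \prod_(k < m | k != j') f k (V k w).
pose c := \prod_(k < m | k != j') fine (\int[P]_w (f k (V k w))%:E).
have int0 k (g : T' -> R) : (forall z, 0 <= g z) -> (0 <= \int[P]_w (g (V k w))%:E)%E.
  by move=> g0; apply: integral_ge0 => w _; rewrite lee_fin.
have c0 : 0 <= c by apply: prodr_ge0 => k _; rewrite fine_ge0// int0.
have cE : (c%:E = \prod_(k < m | k != j') \int[P]_w (f k (V k w))%:E)%E.
  rewrite -prodEFin; apply: eq_bigr => k _; rewrite fineK// ge0_fin_numE//.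
  exact: int0.
rewrite (bigD1 j')//= muleC -cE.
have mfE : measurable_fun setT (fun z => (f j' z)%:E) by exact/measurable_EFinP.
have fE0 z : (0 <= (f j' z)%:E)%E by rewrite lee_fin.
transitivity (\int[P]_w ((G w)%:E * (f j' (V j' w))%:E))%E.
  by apply: eq_integral => w _; rewrite (bigD1 j')//= mulrC EFinM.
(* Here the image measure is [c] times the law of [V j']; on a set [B] this is the induction
   hypothesis with [f j'] replaced by [\1_B]. *)
rewrite (ge0_integral_mulr_comp _ _ _ _ _ _ (mscale (NngNum c0) (distribution P (V j')))
  (V j') _ (fun z => (f j' z)%:E)).
- by rewrite ge0_integral_mscale// ge0_integral_distribution.
- rewrite /G; under eq_fun do rewrite -big_filter.
  by apply: measurable_prod => k _; exact: measurableT_comp.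
- by move=> w; rewrite prodr_ge0.
- move=> B mB; rewrite /mscale/= /distribution/= /pushforward/=.
  pose f' k := if k == j' then \1_B else f k.
  have f'j : f' j' = \1_B by rewrite /f' eqxx.
  have f'k k : k != j' -> f' k = f k by move=> /negbTE kj; rewrite /f' kj.
  have := IH (ltnW jm) f'; rewrite [in X in _ -> _ -> _ -> _ -> X](bigD1 j')//= f'j => E.
  transitivity (\int[P]_w (\prod_k f' k (V k w))%:E)%E.
    apply: eq_integral => w _; rewrite (bigD1 j')//= f'j EFinM muleC.
    by congr (_ * _%:E)%E; apply: eq_bigr => k kj; rewrite f'k.
  have mV : measurable (V j' @^-1` B) by exact: measurable_funPTI.
  rewrite E.
  + rewrite -[X in _ = (X * _)%E]/(c%:E) cE muleC; congr (_ * _)%E.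
      by apply: eq_bigr => k kj; rewrite f'k.
    exact/esym/int1.
  + by move=> k; rewrite /f'; case: ifP.
  + by move=> k z; rewrite /f'; case: ifP.
  + move=> k; rewrite /f'; case: eqP => [->|_]//.
    rewrite (_ : \int[P]_w _ = P (V j' @^-1` B))%E; last first.
      by rewrite int1.
    by rewrite (le_lt_trans (probability_le1 _ _))// ltry.
  + move=> k jk; rewrite /f'; case: eqP => [_|/eqP kj]; first by exists B.
    by apply: ind; rewrite ltn_neqAle jk andbT; apply: contra kj => /eqP jk'; apply/eqP/val_inj.
- exact: mfE.
- exact: fE0.
Qed.

Lemma integral_equal_in_law d0 d d' (T0 : measurableType d0) (T : measurableType d)
    (T' : measurableType d') (R : realType) (P0 : probability T0 R)
    (P : probability T R) (V : {RV P >-> T'}) (V0 : {RV P0 >-> T'}) (f : T' -> R) :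
  equal_in_law V V0 -> measurable_fun setT f -> (forall z, 0 <= f z) ->
  (\int[P]_w (f (V w))%:E = \int[P0]_w (f (V0 w))%:E)%E.
Proof.
move=> VV0 mf f0.
have mfE : measurable_fun setT (fun z => (f z)%:E) by exact/measurable_EFinP.
have fE0 z : (0 <= (f z)%:E)%E by rewrite lee_fin.
rewrite -(ge0_integral_distribution V mfE fE0) -(ge0_integral_distribution V0 mfE fE0).
by apply: eq_measure_integral => A mA _; exact: VV0.
Qed.

End Independence.

Lemma markov_integral d (T : measurableType d) (R : realType) (P : probability T R)
    (F : T -> R) (A : set T) (c : R) :
  measurable A -> measurable_fun setT F -> (forall w, 0 <= F w) -> 0 <= c ->
  (forall w, A w -> c <= F w) -> (c%:E * P A <= \int[P]_w (F w)%:E)%E.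
Proof.
move=> mA mF F0 c0 AF.
rewrite (_ : P A = \int[P]_w (\1_A w)%:E)%E; last by rewrite integral_indic// setIT.
rewrite -ge0_integralZl//; first last.
- exact/measurable_EFinP.
apply: ge0_le_integral => //.
- by move=> w _; rewrite -EFinM lee_fin mulr_ge0.
- by apply: emeasurable_funM => //; exact/measurable_EFinP.
- exact/measurable_EFinP.
- move=> w _; rewrite -EFinM lee_fin indicE.
  by case: (boolP (w \in A)) => [/set_mem/AF|_]; rewrite ?mulr1 ?mulr0.
Qed.

(** Markov's inequality for the exponential of the sum, whose expectation factors by independence
    into [m] equal moments. The sign of [g] is free, so upper and lower deviations are both
    covered. *)
Lemma chernoff_iid d0 d d' (T0 : measurableType d0) (T : measurableType d)
    (T' : measurableType d') (R : realType) (P0 : probability T0 R)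
    (P : probability T R) (V0 : {RV P0 >-> T'}) (m : nat) (V : 'I_m -> {RV P >-> T'})
    (g : T' -> R) (c r : R) :
  iid_copies V0 V -> measurable_fun setT g ->
  (\int[P0]_w (expR (g (V0 w)))%:E <= (expR c)%:E)%E ->
  (P [set w | r <= \sum_k g (V k w)]%R <= (expR (m%:R * c - r))%:E)%E.
Proof.
move=> [indep ident] mg gc.
have mexpg : measurable_fun setT (fun z => expR (g z)) by exact: measurableT_comp.
have intE k : (\int[P]_w (expR (g (V k w)))%:E <= (expR c)%:E)%E.
  by rewrite (integral_equal_in_law _ _ _ _ _ _ _ _ _ _ _ (fun z => expR (g z)) (ident k))// => z; exact: expR_ge0.
have mS : measurable_fun setT (fun w => \sum_k g (V k w)).
  by apply: measurable_sum => k; exact: measurableT_comp.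
have mA : measurable [set w | r <= \sum_k g (V k w)]%R.
  by rewrite -[X in measurable X]setTI; apply: measurable_fun_le.
have mexpS : measurable_fun setT (fun w => expR (\sum_k g (V k w))).
  exact: measurableT_comp.
have H : ((expR r)%:E * P [set w | (r <= \sum_k g (V k w))%R] <= (expR (m%:R * c))%:E)%E.
  apply: (@le_trans _ _ (\int[P]_w (expR (\sum_k g (V k w)))%:E)%E).
    apply: markov_integral => //.
    by move=> w /=; rewrite ler_expR.
  under eq_integral do rewrite expR_sum.
  rewrite (ge0_integral_prod_indep _ _ _ _ _ _ _ V (fun=> fun z => expR (g z)))//.
  - have -> : expR (m%:R * c) = \prod_(k < m) expR c.
      by rewrite prodr_const card_ord expRM_natl.
    have intF k : (\int[P]_w (expR (g (V k w)))%:E)%E =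
        (fine (\int[P]_w (expR (g (V k w)))%:E))%:E.
      rewrite fineK// ge0_fin_numE; first by rewrite (le_lt_trans (intE k))// ltry.
      by apply: integral_ge0 => w _; rewrite lee_fin expR_ge0.
    rewrite (eq_bigr _ (fun k _ => intF k)) prodEFin lee_fin; apply: ler_prod => k _.
    by rewrite -!lee_fin -intF intE andbT; apply: integral_ge0 => w _; rewrite lee_fin expR_ge0.
  - by move=> k; rewrite (le_lt_trans (intE k))// ltry.
by rewrite addrC expRD expRN EFinM lee_pdivlMl ?expR_gt0.
Qed.

(** * Borel measurability of matrix functionals *)

Lemma borel_coord_measurable (R : realType) (m n : nat) (i : 'I_m) (j : 'I_n) :
  measurable_fun setT (fun Z : borel_mx R m n => (Z : 'M[R]_(m, n)) i j).
Proof.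
apply: (measurability _ (RGenOpens.measurableE R)) => _ [_ [a [b ->]] <-].
rewrite setTI; apply: sub_sigma_algebra => /=.
by apply: open_comp; [move=> *; exact: coord_continuous|exact: interval_open].
Qed.

Lemma borel_mxdot_measurable (R : realType) (n : nat) (U : 'M[R]_n) :
  measurable_fun setT (fun Z : borel_mx R n n => mxdot (Z : 'M[R]_n) U).
Proof.
rewrite (_ : (fun _ => _) = (fun Z : borel_mx R n n => \sum_i \sum_j (Z : 'M[R]_n) i j * U i j)); last first.
  by apply/funext => Z; exact: mxdotE.
apply: measurable_sum => i; apply: measurable_sum => j.
by apply: measurable_funM => //; exact: borel_coord_measurable.
Qed.

(** * Moments of a subgaussian variable *)

Section Subgaussian.
Context {d} {T : measurableType d} {R : realType} (P : probability T R).
Context (xi : T -> R) (sigma : R).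
Hypothesis mxi : measurable_fun setT xi.
Hypothesis sigma0 : 0 < sigma.
Hypothesis tail : forall tau, 0 < tau ->
  (P [set w | (tau <= `|xi w|)%R] <=
    (2 * expR (- (tau ^+ 2 / (2 * sigma ^+ 2))))%:E)%E.

Lemma subgaussian_square_exp_moment :
  (\int[P]_w (expR (xi w ^+ 2 / (4 * sigma ^+ 2)))%:E <= 14%:E)%E.
Proof.
have s20 : 0 < sigma ^+ 2 by rewrite exprn_gt0.
(* Layers of width sigma^2 for xi^2: the tail bound turns the moment into a geometric series. *)
pose A (j : nat) := [set w | j%:R * sigma ^+ 2 <= xi w ^+ 2].
have mA j : measurable (A j).
  rewrite /A -[X in measurable X]setTI.
  by apply: measurable_fun_le => //; exact: measurable_funX.
pose a (j : nat) := expR (j.+1%:R / 4) : R.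
have PA j : (P (A j) <= (2 * expR (- (j%:R / 2)))%:E)%E.
  (* The tail hypothesis requires a positive level, so layer 0 uses the trivial bound [1 <= 2]. *)
  have [->|j0] := posnP j.
    rewrite mul0r oppr0 expR0 mulr1 (le_trans (probability_le1 _ (mA _)))// lee_fin.
    lra.
  have t0 : 0 < Num.sqrt j%:R * sigma by rewrite mulr_gt0// sqrtr_gt0 ltr0n.
  have := tail _ t0.
  rewrite exprMn sqr_sqrtr ?ler0n//.
  have -> : j%:R * sigma ^+ 2 / (2 * sigma ^+ 2) = j%:R / 2.
    by field; rewrite gt_eqF.
  suff -> : [set w | (Num.sqrt j%:R * sigma <= `|xi w|)%R] = A j by [].
  apply/seteqP; split => w; rewrite /A /=.
    rewrite -ler_sqr ?nnegrE ?(ltW t0)// exprMn sqr_sqrtr ?ler0n//.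
    by rewrite real_normK// num_real.
  rewrite -[in X in _ -> X]ler_sqr ?nnegrE ?(ltW t0)// exprMn sqr_sqrtr ?ler0n//.
  by rewrite real_normK// num_real.
have mserie j : measurable_fun setT (fun w => ((a j)%:E * (\1_(A j) w)%:E)%E).
  by apply: emeasurable_funM => //; apply/measurable_EFinP; exact: measurable_indic.
have serie0 j w : (0 <= (a j)%:E * (\1_(A j) w)%:E)%E.
  by rewrite mule_ge0 ?lee_fin// expR_ge0.
apply: (@le_trans _ _ (\int[P]_w (\sum_(j <oo) ((a j)%:E * (\1_(A j) w)%:E)))%E).
  apply: ge0_le_integral => //.
  - apply/measurable_EFinP; apply: measurableT_comp => //.
    by apply: measurable_funM => //; exact: measurable_funX.
  - by apply: ge0_emeasurable_sum => // j _; exact: mserie.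
  - move=> w _.
    (* With [j] the integer part of [r], [w] lies in [A j] and [r / 4 <= (j + 1) / 4]; thus one term
       of the series already dominates. *)
    pose r := xi w ^+ 2 / sigma ^+ 2.
    have r0 : 0 <= r by rewrite divr_ge0// ?sqr_ge0// ltW.
    have /andP[jr rj] := truncn_itv r0.
    set j := Num.trunc r in jr rj.
    have wA : w \in A j.
      by rewrite inE /A/= -ler_pdivlMr.
    apply: (@le_trans _ _ ((a j)%:E * (\1_(A j) w)%:E)%E).
      rewrite indicE wA mule1 lee_fin /a ler_expR.
      have -> : xi w ^+ 2 / (4 * sigma ^+ 2) = r / 4.
        by rewrite /r; field; rewrite gt_eqF.
      by rewrite ler_pM2r// ltW.
    apply: le_trans (nneseries_lim_ge j.+1 _); last by move=> *; exact: serie0.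
    by rewrite big_nat_recr//= leeDr// sume_ge0.
rewrite integral_nneseries//.
(* Layer [j] contributes at most [exp((j + 1) / 4) * 2 exp(- j / 2) = (2 / q) q^j]. For [q] between
   [3 / 4] and [4 / 5] the sum [2 / (q (1 - q))] is at most 12.5. *)
pose q := expR (- (4^-1)) : R.
have q34 : 3 / 4 <= q by have := expR_ge1Dx (- (4^-1) : R); rewrite /q; lra.
have q0 : 0 < q by exact: expR_gt0.
have q45 : q <= 4 / 5.
  rewrite /q expRN -[4 / 5]invrK lef_pV2 ?posrE ?expR_gt0 ?invr_gt0 ?divr_gt0//.
  by have := expR_ge1Dx (4^-1 : R); rewrite invf_div; lra.
apply: lime_le; first by apply: is_cvg_nneseries => j _ _; apply: integral_ge0.
apply: nearW => N; apply: (@le_trans _ _ (\sum_(0 <= j < N) (2 / q * q ^+ j)%:E)%E).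
  apply: lee_sum => j _; have aj0 : (0 <= (a j)%:E)%E by rewrite lee_fin expR_ge0.
  have mAj : measurable_fun setT (fun w => (\1_(A j) w)%:E : \bar R).
    exact/measurable_EFinP/measurable_indic.
  rewrite ge0_integralZl//.
  rewrite integral_indic// setIT (@le_trans _ _ ((a j)%:E * (2 * expR (- (j%:R / 2)))%:E)%E)//.
    by apply: lee_wpmul2l => //; exact: PA.
  rewrite -EFinM lee_fin le_eqVlt; apply/orP; left; apply/eqP.
  rewrite /a /q -expRN opprK -expRM_natl mulrCA -!mulrA -!expRD; congr (_ * expR _).
  by rewrite -natr1 mulr_natl; field.
rewrite sumEFin lee_fin.
have qn : `|q| < 1 by rewrite gtr0_norm//; lra.
have := geometric_le_lim N (ltW (divr_gt0 (ltr0Sn R 1) q0)) q0 qn.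
rewrite /series /geometric/= => /le_trans; apply.
rewrite ler_pdivrMr; last by lra.
rewrite ler_pdivrMr//; nra.
Qed.

(** From [x <= exp x] at [x = xi^2 / (4 sigma^2)]; the constant is [4 * 14]. *)
Lemma subgaussian_second_moment :
  (\int[P]_w (xi w ^+ 2)%:E <= (56 * sigma ^+ 2)%:E)%E.
Proof.
have s20 : 0 < sigma ^+ 2 by rewrite exprn_gt0.
have m2 : measurable_fun setT (fun w => xi w ^+ 2) by exact: measurable_funX.
have mE : measurable_fun setT (fun w => expR (xi w ^+ 2 / (4 * sigma ^+ 2))).
  by apply: measurableT_comp => //; apply: measurable_funM.
apply: (@le_trans _ _ (\int[P]_w ((4 * sigma ^+ 2)%:E *
    (expR (xi w ^+ 2 / (4 * sigma ^+ 2)))%:E))%E).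
  apply: ge0_le_integral => //.
  - by move=> w _; rewrite lee_fin sqr_ge0.
  - exact/measurable_EFinP.
  - by apply: emeasurable_funM => //; exact/measurable_EFinP.
  - move=> w _; rewrite -EFinM lee_fin -ler_pdivrMl ?mulr_gt0//.
    by rewrite mulrC (le_trans _ (expR_ge1Dx _))// lerDr.
have c0 : (0 <= (4 * sigma ^+ 2)%:E)%E by rewrite lee_fin mulr_ge0// ltW.
have mEE : measurable_fun setT (fun w => (expR (xi w ^+ 2 / (4 * sigma ^+ 2)))%:E).
  exact/measurable_EFinP.
rewrite ge0_integralZl//.
have -> : (56 * sigma ^+ 2)%:E = ((4 * sigma ^+ 2)%:E * 14%:E)%E.
  by rewrite -EFinM; congr EFin; ring.
by apply: lee_wpmul2l => //; exact: subgaussian_square_exp_moment.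
Qed.

(** The expectation of [exp(- z) <= 1 - z + z^2], valid for [z >= 0], at [z = lambda |xi|]. *)
Lemma subgaussian_laplace_abs (alpha lambda : R) : 0 <= lambda ->
  (alpha%:E <= \int[P]_w (`|xi w|)%:E)%E ->
  (\int[P]_w (expR (- (lambda * `|xi w|)))%:E <=
    (1 - lambda * alpha + 56 * lambda ^+ 2 * sigma ^+ 2)%:E)%E.
Proof.
move=> l0 alphaP.
have mn : measurable_fun setT (fun w => `|xi w|) by exact: measurableT_comp.
have mln : measurable_fun setT (fun w => lambda * `|xi w|) by exact: measurable_funM.
have m2 : measurable_fun setT (fun w => xi w ^+ 2) by exact: measurable_funX.
have mE : measurable_fun setT (fun w => expR (- (lambda * `|xi w|))).
  by apply: measurableT_comp => //; exact: measurableT_comp.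
(* The inequality is arranged as a sum on each side, so that only integrals of nonnegative functions
   occur and no finiteness is presupposed. *)
have key : (\int[P]_w (expR (- (lambda * `|xi w|)))%:E + lambda%:E * \int[P]_w (`|xi w|)%:E
    <= 1 + (lambda ^+ 2)%:E * \int[P]_w (xi w ^+ 2)%:E)%E.
  have mnE : measurable_fun setT (fun w => (`|xi w|)%:E) by exact/measurable_EFinP.
  have mlE : measurable_fun setT (fun w => (lambda * `|xi w|)%:E) by exact/measurable_EFinP.
  have m2E : measurable_fun setT (fun w => (xi w ^+ 2)%:E) by exact/measurable_EFinP.
  have ml2E : measurable_fun setT (fun w => (lambda ^+ 2 * xi w ^+ 2)%:E).
    by apply/measurable_EFinP; exact: measurable_funM.
  have mEE : measurable_fun setT (fun w => (expR (- (lambda * `|xi w|)))%:E).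
    exact/measurable_EFinP.
  have lx0 w : (0 <= (lambda * `|xi w|)%:E)%E by rewrite lee_fin mulr_ge0.
  have x20 w : (0 <= (xi w ^+ 2)%:E)%E by rewrite lee_fin sqr_ge0.
  have lx20 w : (0 <= (lambda ^+ 2 * xi w ^+ 2)%:E)%E by rewrite lee_fin mulr_ge0 ?sqr_ge0.
  have ex0 w : (0 <= (expR (- (lambda * `|xi w|)))%:E)%E by rewrite lee_fin expR_ge0.
  have -> : (lambda%:E * \int[P]_w (`|xi w|)%:E = \int[P]_w (lambda * `|xi w|)%:E)%E.
    by rewrite -ge0_integralZl// lee_fin.
  have -> : ((lambda ^+ 2)%:E * \int[P]_w (xi w ^+ 2)%:E =
      \int[P]_w (lambda ^+ 2 * xi w ^+ 2)%:E)%E.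
    by rewrite -ge0_integralZl// lee_fin sqr_ge0.
  have -> : (1 = \int[P]_w (1%:E : \bar R))%E.
    rewrite -[LHS](probability_setT P) -[LHS]mul1e.
    exact/esym/(integral_cst P measurableT 1%E).
  rewrite -!ge0_integralD//.
  apply: ge0_le_integral => //.
  - by move=> w _; rewrite adde_ge0.
  - exact: emeasurable_funD.
  - exact: emeasurable_funD.
  move=> w _; rewrite -!EFinD lee_fin -(real_normK (num_real (xi w))) -exprMn.
  set z := lambda * `|xi w|; have z0 : 0 <= z by rewrite mulr_ge0.
  have := expR_ge1Dx z; rewrite expRN => ez.
  have e0 := expR_gt0 z.
  (* (1 + z) (1 - z + z^2) = 1 + z^3 *)
  have : (expR z)^-1 <= 1 - z + z ^+ 2; last by lra.
  rewrite -div1r ler_pdivrMr//.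
  have : 0 <= (1 - z + z ^+ 2) * (expR z - (1 + z)) by apply: mulr_ge0; nra.
  have : 0 <= z ^+ 3 by rewrite exprn_ge0.
  nra.
have la : ((lambda * alpha)%:E <= lambda%:E * \int[P]_w (`|xi w|)%:E)%E.
  by rewrite EFinM; apply: lee_wpmul2l.
have l2 : (1 + (lambda ^+ 2)%:E * \int[P]_w (xi w ^+ 2)%:E <=
    (1 + lambda ^+ 2 * (56 * sigma ^+ 2))%:E)%E.
  rewrite EFinD leeD2l// [leRHS]EFinM; apply: lee_wpmul2l; first by rewrite lee_fin sqr_ge0.
  exact: subgaussian_second_moment.
have := le_trans (leeD2l _ la) (le_trans key l2).
rewrite -leeBrDr// -EFinB => /le_trans; apply.
by rewrite lee_fin le_eqVlt; apply/orP; left; apply/eqP; ring.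
Qed.

End Subgaussian.

(** * Deterministic recovery: cone condition and error bound *)

Section Recovery.
Context {R : realType}.

(** Feasibility of [X] bounds the largest column norm of [Z] by that of [X], which by flatness is
    the norm of every column of [X]. So no column of [Z] exceeds its counterpart in [X], which
    places at least half of the l1 mass of the error on the support of [X], where Cauchy-Schwarz
    applies. *)
Lemma minimizer_error_cone (m n s : nat) (A : 'I_m -> 'M[R]_n) (y : 'cV[R]_m)
    (eta : R) (X Z : 'M[R]_n) :
  col_sparse s X -> l1_col_flat X -> feasible A y eta X -> is_minimizer A y eta Z ->
  entry_l1norm (Z - X) ^+ 2 <= 4 * (n%:R * s%:R) * frobnorm (Z - X) ^+ 2.
Proof.
move=> Xs Xflat Xfeas [_ /(_ X Xfeas) ZX].
have ZXj j : \sum_i `|Z i j| <= \sum_i `|X i j|.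
  have colE (M : 'M[R]_n) : \sum_i `|M i j| = l1norm (col j M).
    by apply: eq_bigr => i _; rewrite mxE.
  rewrite !colE; apply: le_trans (le_trans ZX _).
    exact: (le_bigmax _ (fun j => l1norm (col j Z)) j).
  apply: bigmax_le; first exact: sumr_ge0.
  by move=> k _; rewrite (Xflat k j).
set H := Z - X.
pose Q := [pred ij : 'I_n * 'I_n | X ij.1 ij.2 != 0].
pose e (ij : 'I_n * 'I_n) := H ij.1 ij.2.
have cone : entry_l1norm H <= 2 * \sum_(ij | Q ij) `|e ij|.
  rewrite big_mkcond/= -(pair_bigA _ (fun i j => if X i j != 0 then `|H i j| else 0))/=.
  rewrite /entry_l1norm exchange_big/= [in leRHS]exchange_big/= mulr_sumr.
  apply: ler_sum => j _; rewrite mulr_sumr -subr_le0 -sumrB.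
  (* Off the support [|H i j| = |Z i j|], and on it [- |H i j| <= |Z i j| - |X i j|]; over a column
     these differences sum to at most 0. *)
  apply: (@le_trans _ _ (\sum_i (`|Z i j| - `|X i j|))); last first.
    by rewrite sumrB subr_le0.
  apply: ler_sum => i _; rewrite /H [(Z - X) i j]mxE [(- X) i j]mxE.
  case: eqP => [->|_] /=; first by rewrite mulr0 normr0 !subr0.
  have : `|X i j| <= `|Z i j| + `|Z i j - X i j|.
    by rewrite -{1}(subKr (Z i j) (X i j)) ler_normB.
  lra.
have cardQ : #|Q|%:R <= n%:R * s%:R :> R.
  rewrite -natrM ler_nat -sum1_card.
  rewrite big_mkcond/= -(pair_bigA _ (fun i j => if X i j != 0 then 1%N else 0%N))/=.
  rewrite exchange_big/= -[n in (_ <= n * s)%N]card_ord -sum_nat_const.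
  apply: leq_sum => j _; rewrite -big_mkcond/= sum1_card.
  by rewrite (leq_trans _ (Xs j))// cardsE.
have e2 : \sum_(ij | Q ij) e ij ^+ 2 <= frobnorm H ^+ 2.
  rewrite frobnorm_sqr pair_bigA/= big_mkcond; apply: ler_sum => ij _.
  by case: ifP => // _; exact: sqr_ge0.
set N := n%:R * s%:R in cardQ *.
have H0 : 0 <= entry_l1norm H by apply: sumr_ge0 => i _; exact: sumr_ge0.
(* The radius passed to [sum_norm_le] below is [frobnorm H / Num.sqrt N]; it must be positive, so
   [H = 0] and [N = 0] are treated apart. *)
have [->|Hn0] := eqVneq H 0.
  by rewrite frobnorm0 (_ : entry_l1norm 0 = 0) ?expr0n ?mulr0//; apply/eqP; rewrite entry_l1norm_eq0.
have f0 : 0 < frobnorm H.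
  by rewrite lt_def frobnorm_ge0 andbT; apply: contra_neq Hn0; exact: frobnorm_eq0.
have [N0|N0] := eqVneq N 0.
  suff : entry_l1norm H <= 0 by rewrite N0 mulr0 mul0r => h; rewrite (le_anti (introT andP (conj h H0))) expr0n.
  apply: (le_trans cone); rewrite big_pred0 ?mulr0// => ij.
  by apply/negbTE/negP => Qij; move: cardQ; rewrite N0 lern0 => /eqP/card0_eq Q0; have : ij \in Q by []; rewrite Q0.
have Npos : 0 < N by rewrite lt_def N0 mulr_ge0.
have sN : 0 < Num.sqrt N by rewrite sqrtr_gt0.
have sN2 : Num.sqrt N ^+ 2 = N by rewrite sqr_sqrtr// ltW.
have := sum_norm_le _ Q e N (frobnorm H / Num.sqrt N) (divr_gt0 f0 sN) cardQ.
have -> : N * (frobnorm H / Num.sqrt N) ^+ 2 = frobnorm H ^+ 2.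
  by rewrite -{1}sN2; field; rewrite gt_eqF.
have -> : N * (frobnorm H / Num.sqrt N) = Num.sqrt N * frobnorm H.
  by rewrite -{1}sN2; field; rewrite gt_eqF.
move=> /(_ e2) eN.
have : entry_l1norm H <= 2 * (Num.sqrt N * frobnorm H) by lra.
rewrite -ler_sqr ?nnegrE//; last by rewrite !mulr_ge0// ltW.
by rewrite !exprMn sN2 => /le_trans; apply; rewrite le_eqVlt; apply/orP; left; apply/eqP; ring.
Qed.

Lemma l2norm_le (m : nat) (v : 'cV[R]_m) (eta : R) : 0 <= eta ->
  l2norm v <= eta -> \sum_k v k 0 ^+ 2 <= eta ^+ 2.
Proof.
move=> eta0; rewrite -ler_sqr ?nnegrE ?sqrtr_ge0// sqr_sqrtr//.
by apply: sumr_ge0 => k _; exact: sqr_ge0.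
Qed.

(** [X] and [Z] both match [y] up to [eta], so the measurements of [Z - X] have squared l2-norm at
    most [4 eta^2]; Cauchy-Schwarz makes this an l1 bound to set against the lower bound. The
    constant is [16^2 = 4 * 8^2]. *)
Lemma recovery_error_le (m n : nat) (A : 'I_m -> 'M[R]_n) (y : 'cV[R]_m)
    (eta alpha delta : R) (X Z : 'M[R]_n) :
  (0 < m)%N -> 0 <= eta -> 0 < alpha -> 0 < delta ->
  16 ^+ 2 * eta ^+ 2 <= m%:R * (alpha ^+ 2 * delta ^+ 2) ->
  feasible A y eta X -> feasible A y eta Z ->
  m%:R * (alpha / 8 * frobnorm (Z - X)) <= \sum_k `|mxdot (A k) (Z - X)| ->
  frobnorm (Z - X) <= delta.
Proof.
move=> m0 eta0 a0 d0 m_ge Xf Zf low.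
have mR : 0 < m%:R :> R by rewrite ltr0n.
have ad : 0 < alpha * delta / 8 by rewrite divr_gt0// mulr_gt0.
have up : \sum_k `|mxdot (A k) (Z - X)| <= m%:R * (alpha * delta / 8).
  apply: sum_norm_le => //; first by rewrite card_ord.
  have := l2norm_le _ _ _ eta0 Xf; have := l2norm_le _ _ _ eta0 Zf.
  set SZ := \sum_k _; set SX := \sum_k _ => hZ hX.
  suff : \sum_k mxdot (A k) (Z - X) ^+ 2 <= 2 * SX + 2 * SZ.
    move=> /le_trans; apply; rewrite exprMn exprMn; lra.
  rewrite !mulr_sumr -big_split/=; apply: ler_sum => k _.
  rewrite mxdotBr !mxE.
  have := sqr_ge0 (2 * y k 0 - mxdot (A k) X - mxdot (A k) Z); nra.
have : m%:R * (alpha / 8 * frobnorm (Z - X)) <= m%:R * (alpha / 8 * delta).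
  by apply: (le_trans low); apply: (le_trans up); rewrite mulrAC.
by rewrite ler_pM2l// ler_pM2l// divr_gt0.
Qed.

End Recovery.

(** * Union bound over entries and net points *)

Lemma measure_bigcup_fin_le d (T : measurableType d) (R : realType)
    (P : probability T R) (I : finType) (B : I -> set T) (r : R) :
  (forall i, measurable (B i)) -> (forall i, P (B i) <= r%:E)%E ->
  measurable (\bigcup_i B i) /\ (P (\bigcup_i B i) <= (#|I|%:R * r)%:E)%E.
Proof.
move=> mB Br.
have -> : \bigcup_i B i = \big[setU/set0]_(i <- index_enum I) B i.
  by rewrite -bigcup_seq; congr bigcup; apply/seteqP; split => i //= _; rewrite mem_index_enum.
have -> : #|I| = size (index_enum I) by rewrite cardT enumT [index_enum I]unlock.
elim: (index_enum I) => [|i s [mS PS]].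
  by rewrite big_nil measure0 mul0r.
rewrite big_cons; split; first exact: measurableU.
apply: (@le_trans _ _ (P (B i) + P (\big[setU/set0]_(j <- s) B j))%E).
  exact: measureU2.
by rewrite /= -natr1 mulrDl mul1r addrC EFinD leeD.
Qed.

(* Here [56 * sigma ^+ 2] is the bound on E <Phi, U>^2; multiples of 56 are left unevaluated
   because large numerals are expanded in unary. *)
Section GoodEvent.
Context {d0 d} {T0 : measurableType d0} {T : measurableType d} {R : realType}.
Context {P0 : probability T0 R} {P : probability T R} {m n : nat}.
Context {Phi0 : {RV P0 >-> borel_mx R n n}} {Phi : 'I_m -> {RV P >-> borel_mx R n n}}.
Context {alpha sigma : R}.
Hypothesis iid : iid_copies Phi0 Phi.
Hypothesis alpha0 : 0 < alpha.
Hypothesis alphaP : forall U : 'M[R]_n, frobnorm U = 1 ->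
  (alpha%:E <= 'E_P0[fun w => (`|mxdot (Phi0 w) U|)%R])%E.
Hypothesis sigma0 : 0 < sigma.
Hypothesis sigmaP : forall (tau : R) (U : 'M[R]_n), 0 < tau -> frobnorm U = 1 ->
  (P0 [set w | (tau <= `|mxdot (Phi0 w) U|)%R] <=
    (2 * expR (- (tau ^+ 2 / (2 * sigma ^+ 2))))%:E)%E.

Let mxi (U : 'M[R]_n) : measurable_fun setT (fun w => mxdot (Phi0 w) U).
Proof. exact: (measurableT_comp (borel_mxdot_measurable _ _ U)). Qed.

Let laplace (U : 'M[R]_n) (lambda : R) : frobnorm U = 1 -> 0 <= lambda ->
  (\int[P0]_w (expR (- (lambda * `|mxdot (Phi0 w) U|)))%:E <=
    (1 - lambda * alpha + 56 * lambda ^+ 2 * sigma ^+ 2)%:E)%E.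
Proof.
move=> U1 l0; have := alphaP _ U1; rewrite unlock.
by apply: subgaussian_laplace_abs => // tau tau0; exact: sigmaP.
Qed.

(** A Laplace transform is nonnegative, while its upper bound at the minimizing
    [lambda = alpha / (2 * 56 * sigma^2)] is [1 - alpha^2 / (4 * 56 * sigma^2)]. A positive [n]
    supplies a matrix of norm 1. *)
Lemma sqr_alpha_le : (0 < n)%N -> alpha ^+ 2 <= 4 * 56 * sigma ^+ 2.
Proof.
move=> n0; pose i0 := Ordinal n0.
have s20 : 0 < sigma ^+ 2 by rewrite exprn_gt0.
have l0 : 0 <= alpha / (2 * 56 * sigma ^+ 2) by rewrite divr_ge0// ?mulr_ge0// ltW.
have := laplace _ _ (frobnorm_delta i0 i0) l0.
set I := (\int[P0]_w _)%E => Ile.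
have I0 : (0 <= I)%E by apply: integral_ge0 => w _; rewrite lee_fin expR_ge0.
have := le_trans I0 Ile; rewrite lee_fin.
have -> : 1 - alpha / (2 * 56 * sigma ^+ 2) * alpha +
    56 * (alpha / (2 * 56 * sigma ^+ 2)) ^+ 2 * sigma ^+ 2 =
    1 - alpha ^+ 2 / (4 * 56 * sigma ^+ 2) by field; rewrite gt_eqF.
by rewrite subr_ge0 ler_pdivrMr ?mul1r// mulr_gt0.
Qed.

(** The event says that the average of [|<Phi_k, U>|] is at most [alpha / 2], multiplied by
    [- lambda] to fit [chernoff_iid]. The value [lambda = alpha / (4 * 56 * sigma^2)] minimizes the
    exponent [- lambda alpha / 2 + 56 lambda^2 sigma^2]. *)
Lemma small_average_probability (U : 'M[R]_n) : frobnorm U = 1 ->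
  (P [set w | - (alpha / (4 * 56 * sigma ^+ 2) * (m%:R * (alpha / 2))) <=
      \sum_k - (alpha / (4 * 56 * sigma ^+ 2) * `|mxdot (Phi k w) U|)]%R
    <= (expR (- (m%:R * (alpha ^+ 2 / (16 * 56 * sigma ^+ 2)))))%:E)%E.
Proof.
move=> U1; set lambda := alpha / (4 * 56 * sigma ^+ 2).
have s20 : 0 < sigma ^+ 2 by rewrite exprn_gt0.
have l0 : 0 <= lambda by rewrite divr_ge0// ?mulr_ge0// ltW.
pose g (Z : borel_mx R n n) : R := - (lambda * `|mxdot (Z : 'M[R]_n) U|).
pose c := - lambda * alpha + 56 * lambda ^+ 2 * sigma ^+ 2.
have mg : measurable_fun setT g.
  apply: measurableT_comp => //; apply: measurable_funM => //.
  by apply: measurableT_comp => //; exact: borel_mxdot_measurable.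
have gc : (\int[P0]_w (expR (g (Phi0 w)))%:E <= (expR c)%:E)%E.
  apply: (le_trans (laplace _ _ U1 l0)); rewrite lee_fin.
  by apply: le_trans (expR_ge1Dx c); rewrite /c mulNr addrA.
have := chernoff_iid _ _ _ _ _ _ _ _ _ _ _ _ g c (- (lambda * (m%:R * (alpha / 2)))) iid mg gc.
rewrite [X in expR X](_ : _ = - (m%:R * (alpha ^+ 2 / (16 * 56 * sigma ^+ 2))))//.
by rewrite /c /lambda; field; rewrite gt_eqF.
Qed.

(** With the crude [14 <= exp 14] for the moment, a threshold of 15 per measurement leaves
    [exp(- m)]; for the squared entries this is the level [60 sigma^2]. *)
Lemma large_entry_probability (i j : 'I_n) :
  (P [set w | m%:R * 15 <=
      \sum_k (Phi k w : 'M[R]_n) i j ^+ 2 / (4 * sigma ^+ 2)]%R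
    <= (expR (- m%:R))%:E)%E.
Proof.
pose g (Z : borel_mx R n n) : R := (Z : 'M[R]_n) i j ^+ 2 / (4 * sigma ^+ 2).
have mg : measurable_fun setT g.
  by apply: measurable_funM => //; apply: measurable_funX; exact: borel_coord_measurable.
have gc : (\int[P0]_w (expR (g (Phi0 w)))%:E <= (expR 14)%:E)%E.
  apply: (@le_trans _ _ 14%:E).
    have xiE w : mxdot (Phi0 w) (delta_mx i j) = (Phi0 w : 'M[R]_n) i j by exact: mxdot_delta.
    have := subgaussian_square_exp_moment P0 _ _ (mxi (delta_mx i j)) sigma0.
    move=> /(_ (fun tau tau0 => sigmaP _ _ tau0 (frobnorm_delta i j))).
    by under eq_integral do rewrite xiE.
  by rewrite lee_fin (le_trans _ (expR_ge1Dx _))// lerDr.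
have := chernoff_iid _ _ _ _ _ _ _ _ _ _ _ _ g 14 (m%:R * 15) iid mg gc.
by rewrite [X in expR X](_ : _ = - m%:R)//; ring.
Qed.

Lemma bad_event (L : nat) : (0 < n)%N ->
  exists B : set T, [/\ measurable B,
    (P B <= (((n * n) + (n * n * 2) ^ L)%:R *
        expR (- (m%:R * (alpha ^+ 2 / (16 * 56 * sigma ^+ 2)))))%:E)%E &
    forall w, ~ B w ->
      (forall i j, \sum_k (Phi k w : 'M[R]_n) i j ^+ 2 <= m%:R * (60 * sigma ^+ 2)) /\
      (forall t : L.-tuple ('I_n * 'I_n * bool),
        m%:R * (alpha / 2 * frobnorm (net_point L t))
          <= \sum_k `|mxdot (Phi k w) (net_point L t)|)].
Proof.
move=> n0.
have s20 : 0 < sigma ^+ 2 by rewrite exprn_gt0.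
pose U t : 'M[R]_n := (frobnorm (net_point L t))^-1 *: net_point L t.
have U1 t : net_point L t != 0 :> 'M[R]_n -> frobnorm (U t) = 1.
  move=> tn0; rewrite /U frobnormZ ger0_norm ?invr_ge0 ?frobnorm_ge0// mulVf//.
  by apply: contra_neq tn0; exact: frobnorm_eq0.
pose lambda := alpha / (4 * 56 * sigma ^+ 2).
have l0 : 0 < lambda by rewrite divr_gt0// mulr_gt0.
(* A vanishing net point cannot be normalized, but it satisfies the required inequality trivially,
   so its event is empty. *)
pose B (x : ('I_n * 'I_n) + L.-tuple ('I_n * 'I_n * bool)) : set T :=
  match x with
  | inl ij => [set w | m%:R * 15 <=
      \sum_k (Phi k w : 'M[R]_n) ij.1 ij.2 ^+ 2 / (4 * sigma ^+ 2)]
  | inr t => if net_point L t == 0 :> 'M[R]_n then set0 else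
      [set w | - (lambda * (m%:R * (alpha / 2))) <=
        \sum_k - (lambda * `|mxdot (Phi k w) (U t)|)]
  end.
have mB x : measurable (B x).
  case: x => [[i j]|t] /=.
    rewrite -[X in measurable X]setTI; apply: measurable_fun_le => //.
    apply: measurable_sum => k; apply: measurable_funM => //; apply: measurable_funX.
    exact: (measurableT_comp (borel_coord_measurable _ _ _ i j)).
  case: ifP => // _.
  rewrite -[X in measurable X]setTI; apply: measurable_fun_le => //.
  apply: measurable_sum => k; apply: measurableT_comp => //; apply: measurable_funM => //.
  apply: measurableT_comp => //.
  exact: (measurableT_comp (borel_mxdot_measurable _ _ (U t))).
have PB x : (P (B x) <= (expR (- (m%:R * (alpha ^+ 2 / (16 * 56 * sigma ^+ 2)))))%:E)%E.
  case: x => [[i j]|t] /=.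
    apply: (le_trans (large_entry_probability i j)).
    (* By [sqr_alpha_le] the factor [alpha^2 / (16 * 56 * sigma^2)] is at most 1, so [exp(- m)]
       obeys the common bound too. *)
    rewrite lee_fin ler_expR lerN2 ler_piMr// ler_pdivrMr ?mulr_gt0// mul1r.
    have := sqr_alpha_le n0; lra.
  case: ifPn => [_|tn0]; first by rewrite measure0 lee_fin expR_ge0.
  exact: small_average_probability (U1 _ tn0).
have [mBB PBB] := measure_bigcup_fin_le _ _ _ P _ _ _ mB PB.
exists (\bigcup_x B x); split => //.
  by move: PBB; rewrite card_sum card_tuple !card_prod card_ord card_bool.
move=> w wB; split=> [i j|t].
  have : ~ B (inl (i, j)) w by move=> Bw; apply: wB; exists (inl (i, j)).
  rewrite /B/= => /negP; rewrite -ltNge -mulr_suml ltr_pdivrMr ?mulr_gt0// => /ltW.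
  by move=> /le_trans; apply; rewrite le_eqVlt; apply/orP; left; apply/eqP; ring.
have : ~ B (inr t) w by move=> Bw; apply: wB; exists (inr t).
rewrite /B/=; have [->|tn0] := eqVneq (net_point L t) (0 : 'M[R]_n).
  by rewrite frobnorm0 !mulr0 sumr_ge0.
move=> /negP; rewrite -ltNge sumrN ltrN2 -mulr_sumr ltr_pM2l// => /ltW.
have f0 : 0 < frobnorm (net_point L t : 'M[R]_n).
  by rewrite lt_def frobnorm_ge0 andbT; apply: contra_neq tn0; exact: frobnorm_eq0.
move=> h; rewrite mulrA -ler_pdivlMr//; apply: (le_trans h).
rewrite le_eqVlt; apply/orP; left; apply/eqP; rewrite mulr_suml; apply: eq_bigr => k _.
by rewrite /U mxdotZr normrM gtr0_norm ?invr_gt0// mulrC.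
Qed.

End GoodEvent.

Lemma frobnorm_sub_measurable (R : realType) (n : nat) (X : 'M[R]_n) (delta : R) :
  measurable [set Z : borel_mx R n n | frobnorm ((Z : 'M[R]_n) - X) <= delta].
Proof.
rewrite -[X in measurable X]setTI; apply: measurable_fun_le => //.
apply: (measurableT_comp (continuous_measurable_fun (@sqrt_continuous R))).
apply: measurable_sum => i; apply: measurable_sum => j; apply: measurable_funX.
rewrite (_ : (fun _ => _) = (fun Z : borel_mx R n n => (Z : 'M[R]_n) i j - X i j)).
  by apply: measurable_funB => //; exact: borel_coord_measurable.
by apply/funext => Z; rewrite [LHS]mxE; congr (_ + _); rewrite mxE.
Qed.

(** * Size of the net against the logarithmic factor *)

Section Constants.
Context {R : realType}.

(** The choice [expR 1] for [C3] keeps the logarithm at least 1 even for [n = 1], so that absolute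
    constants can be absorbed into it. *)
Lemma log_factor_ge1 (n : nat) : (0 < n)%N -> 1 <= ln (expR 1 * n%:R ^+ 6 : R).
Proof.
move=> n0; have n6 : 1 <= n%:R ^+ 6 :> R by rewrite exprn_ege1// ler1n.
rewrite -[leLHS]expRK ler_ln ?posrE ?expR_gt0 ?mulr_gt0 ?exprn_gt0 ?ltr0n ?expR_gt0//.
by rewrite ler_peMr// expR_ge0.
Qed.

(** Since [2 n^2 <= e n^6], each summand is at most [exp(L Lam)], with [Lam] the logarithm; the
    factor 2 from adding them is absorbed by [2 <= e <= exp(L Lam)]. *)
Lemma net_cardinality_le (n L : nat) : (0 < n)%N -> (0 < L)%N ->
  ((n * n) + (n * n * 2) ^ L)%:R
    <= expR (2 * (L%:R * ln (expR 1 * n%:R ^+ 6))) :> R.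
Proof.
move=> n0 L0; set Lam := ln _.
have Lam1 : 1 <= Lam by exact: log_factor_ge1.
have e2 : 2 <= expR 1 :> R by have := expR_ge1Dx (1 : R); lra.
have base : (n * n * 2)%:R <= expR Lam :> R.
  rewrite lnK ?posrE ?mulr_gt0 ?expR_gt0 ?exprn_gt0 ?ltr0n//.
  rewrite natrM mulrC; apply: ler_pM => //.
  by rewrite -natrX ler_nat mulnn leq_pexp2l.
have pow : ((n * n * 2) ^ L)%:R <= expR (L%:R * Lam) :> R.
  by rewrite natrX expRM_natl lerXn2r ?nnegrE ?expR_ge0.
have LL : 1 <= L%:R * Lam.
  have : 1 <= L%:R :> R by rewrite ler1n.
  nra.
apply: (@le_trans _ _ (2 * expR (L%:R * Lam))).
  rewrite natrD (_ : 2 = 1 + 1)// mulrDl mul1r lerD//; apply: le_trans pow.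
  rewrite ler_nat (leq_trans (leq_pmulr (n * n) (isT : 0 < 2)%N))//.
  rewrite -[leqLHS]expn1 leq_pexp2l// !muln_gt0 n0//.
apply: (@le_trans _ _ (expR 1 * expR (L%:R * Lam))).
  by rewrite ler_wpM2r// expR_ge0.
by rewrite -expRD ler_expR; lra.
Qed.

End Constants.

(* The factor is 1 / alpha ^ 2: the claim is invariant under scaling Phi, e,
   eta (hence alpha, sigma) by a common factor, and fails with 1 / alpha. *)
Theorem theorem5p2 (R : realType) :
  exists C1 C2 C3 C4 : R,
    [/\ 0 < C1, 0 < C2, 0 < C3 & 0 < C4] /\
    forall (d0 : measure_display) (T0 : measurableType d0)
      (P0 : probability T0 R) (d : measure_display) (T : measurableType d)
      (P : probability T R) (m n s : nat)
      (Phi0 : {RV P0 >-> borel_mx R n n})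
      (Phi : 'I_m -> {RV P >-> borel_mx R n n})
      (alpha sigma : R) (X : 'M[R]_n) (eta : R)
      (e : {RV P >-> borel_mx R m 1}) (y : T -> 'cV[R]_m)
      (Xstar : {RV P >-> borel_mx R n n}) (t delta : R),
    iid_copies Phi0 Phi ->
    (forall i j : 'I_n, ('E_P0[fun w => (Phi0 w : 'M[R]_n) i j] = 0)%E) ->
    0 < alpha ->
    (forall U : 'M[R]_n, frobnorm U = 1 ->
      (alpha%:E <= 'E_P0[fun w => (`|mxdot (Phi0 w) U|)%R])%E) ->
    0 < sigma ->
    (forall (tau : R) (U : 'M[R]_n), 0 < tau -> frobnorm U = 1 ->
      (P0 [set w | (tau <= `|mxdot (Phi0 w) U|)%R] <=
        (2 * expR (- (tau ^+ 2 / (2 * sigma ^+ 2))))%:E)%E) ->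
    col_sparse s X ->
    l1_col_flat X ->
    0 <= eta ->
    (forall w : T, l2norm (e w) <= eta) ->
    (forall w : T, y w = measurement (fun k => Phi k w) X + e w) ->
    {ae P, forall w : T, eta < l2norm (y w)} ->
    (forall w : T, is_minimizer (fun k => Phi k w) (y w) eta (Xstar w)) ->
    0 < t ->
    0 < delta ->
    let rho := sigma / alpha in
    C1 * rho ^+ 4 / alpha ^+ 2 *
      (alpha * t + 2 * eta / delta +
       sigma * C2 *
         Num.sqrt (rho ^+ 6 * n%:R * s%:R * ln (C3 * n%:R ^+ 6))) ^+ 2
      <= m%:R ->
    ((1 - expR (- (C4 * t ^+ 2)))%:E <=
      P [set w | (frobnorm ((Xstar w : 'M[R]_n) - X) <= delta)%R])%E.
Proof.
(* [16 * 56] comes from the probability exponent, [2 * 14 ^+ 4] from the exponent [2 L Lam] of the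
   net size with [L <= 14^4 rho^2 n s], and [(4 * 56) ^+ 4] compensates surplus powers of [rho], as
   [4 * 56 * rho^2 >= 1]. *)
exists (2 * 14 ^+ 4 * (16 * 56) * (4 * 56) ^+ 4), 1, (expR 1), (2 * 14 ^+ 4 * (4 * 56) ^+ 3).
split; first by split; rewrite ?expR_gt0// !mulr_gt0// exprn_gt0.
move=> d0 T0 P0 d T P m n s Phi0 Phi alpha sigma X eta e y Xstar t delta.
move=> iid _ a0 alphaP s0 sigmaP Xs Xflat eta0 e_le yE _ Xmin t0 del0 rho m_ge.
set C1 := 2 * 14 ^+ 4 * (16 * 56) * (4 * 56) ^+ 4 in m_ge.
have C10 : 0 < C1 by rewrite /C1 !mulr_gt0// exprn_gt0.
have C1E : C1 = 2 * 14 ^+ 4 * (16 * 56) * (4 * 56) ^+ 4 by [].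
clearbody C1.
have rho0 : 0 < rho by rewrite divr_gt0.
have Xfeas w : feasible (fun k => Phi k w) (y w) eta X.
  by rewrite /feasible yE addrAC subrr add0r; exact: e_le.
have cone w := minimizer_error_cone _ _ _ _ _ _ _ _ Xs Xflat (Xfeas w) (Xmin w).
have mE : measurable [set w | (frobnorm ((Xstar w : 'M[R]_n) - X) <= delta)%R].
  exact: (measurable_funPTI (Xstar : {mfun _ >-> _}) (frobnorm_sub_measurable _ _ X delta)).
(* If [n * s = 0], then [m] may be small, but the cone condition forces a zero error. *)
have [ns0|ns0] := posnP (n * s).
  rewrite (_ : [set w | _] = setT).
    by rewrite probability_setT lee_fin gerBl expR_ge0.
  apply/seteqP; split => // w _ /=.
  have := cone w; rewrite -natrM ns0 mulr0 mul0r => h.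
  suff -> : (Xstar w : 'M[R]_n) - X = 0 by rewrite frobnorm0 ltW.
  by apply/eqP; rewrite -entry_l1norm_eq0 -sqrf_eq0 eq_le h sqr_ge0.
have [n0 sp0] : (0 < n)%N /\ (0 < s)%N by apply/andP; rewrite -muln_gt0.
set Lam := ln _ in m_ge.
have Lam1 : 1 <= Lam by exact: log_factor_ge1.
pose N : R := n%:R * s%:R.
have N1 : 1 <= N by rewrite /N -natrM ler1n.
have Lam0 : 0 <= Lam := le_trans ler01 Lam1.
have N0 : 0 <= N := le_trans ler01 N1.
have s20 : 0 < sigma ^+ 2 by rewrite exprn_gt0.
have a20 : 0 < alpha ^+ 2 by rewrite exprn_gt0.
pose u := rho ^+ 2.
have uE : u * alpha ^+ 2 = sigma ^+ 2 by rewrite /u /rho; field; rewrite gt_eqF.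
have u0 : 0 < u by rewrite exprn_gt0.
clearbody rho.
have Ku_ge1 : 1 <= 4 * 56 * u.
  have := sqr_alpha_le a0 alphaP s0 sigmaP n0.
  by rewrite -uE mulrA -{1}[alpha ^+ 2]mul1r ler_pM2r.
(* All three summands in the square are nonnegative: the first and third give [m_t], the second
   alone gives [m_eta]. *)
have [m_t m_eta m_gt0] : [/\ C1 * u ^+ 2 * t ^+ 2 + C1 * u ^+ 6 * (N * Lam) <= m%:R,
    C1 * u ^+ 2 * (4 * eta ^+ 2) <= m%:R * (alpha ^+ 2 * delta ^+ 2)
    & (0 < m)%N].
  move: m_ge; set q := Num.sqrt _; set b := 2 * eta / delta.
  have q0 : 0 <= q by exact: sqrtr_ge0.
  have b0 : 0 <= b by rewrite divr_ge0 ?mulr_ge0// ltW.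
  have q2 : q ^+ 2 = u ^+ 3 * (N * Lam).
    have r60 : 0 <= rho ^+ 6 by rewrite exprn_ge0// ltW.
    rewrite sqr_sqrtr; last first.
      by rewrite (mulr_ge0 (mulr_ge0 (mulr_ge0 r60 _) _) Lam0).
    by rewrite /u /N -exprM; ring.
  have c0 : 0 < C1 * rho ^+ 4 / alpha ^+ 2 by rewrite divr_gt0// mulr_gt0// exprn_gt0.
  have at0 : 0 < alpha * t by rewrite mulr_gt0.
  rewrite mulr1; have sq0 : 0 <= sigma * q by rewrite mulr_ge0// ltW.
  move=> m_ge.
  have m_t : C1 * u ^+ 2 * t ^+ 2 + C1 * u ^+ 6 * (N * Lam) <= m%:R.
    apply: le_trans m_ge.
    apply: (@le_trans _ _ (C1 * rho ^+ 4 / alpha ^+ 2 * ((alpha * t) ^+ 2 + (sigma * q) ^+ 2))).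
      rewrite !exprMn q2 -uE /u le_eqVlt; apply/orP; left; apply/eqP.
      by field; rewrite gt_eqF.
    rewrite ler_pM2l//; nra.
  split => //.
    have : C1 * rho ^+ 4 / alpha ^+ 2 * b ^+ 2 <= m%:R.
      apply: le_trans m_ge; rewrite ler_pM2l// ler_sqr ?nnegrE ?addr_ge0//; last exact: ltW.
      by rewrite -addrA addrCA lerDl addr_ge0// ltW.
    rewrite -(ler_pM2r (mulr_gt0 a20 (exprn_gt0 2 del0))).
    apply: le_trans; rewrite le_eqVlt; apply/orP; left; apply/eqP.
    by rewrite /b /u; field; rewrite !gt_eqF.
  rewrite -(ltr0n R); apply: lt_le_trans m_t.
  rewrite ltr_pwDl ?mulr_gt0 ?exprn_gt0//.
  exact: mulr_ge0 (mulr_ge0 (ltW C10) (exprn_ge0 6 (ltW u0))) (mulr_ge0 N0 Lam0).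
have uN : N <= 4 * 56 * u * N by rewrite ler_peMl.
have x0 : 0 <= 32 * N + 128 * (60 * u) * (4 * N).
  by have := mulr_ge0 (ltW u0) N0; lra.
(* The two conditions of [net_lower_bound] for [beta = 4 N] and [tau = 60 sigma^2], added up.
   Rounding up costs at most [1 <= N], and [33 N <= 33 * 224 u N]; in all
   [(30720 + 7392) u N <= 14^4 u N]. *)
pose L := (Num.trunc (32 * N + 128 * (60 * u) * (4 * N))).+1.
have /andP[L_le' /ltW L_ge] := truncn_itv x0; rewrite -/L in L_ge.
have L_le : L%:R <= 14 ^+ 4 * u * N.
  by rewrite /L -natr1; lra.
clearbody L.
have L0 : (0 < L)%N.
  rewrite -(ltr0n R); apply: lt_le_trans L_ge; lra.
have [B [mB PB goodB]] := bad_event iid a0 alphaP s0 sigmaP L n0.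
have BE w : ~ B w -> frobnorm ((Xstar w : 'M[R]_n) - X) <= delta.
  move=> /goodB[entries net].
  apply: (recovery_error_le _ _ (fun k => Phi k w) (y w) eta alpha) => //.
  - apply: le_trans m_eta; rewrite mulrA ler_wpM2r ?sqr_ge0//.
    have -> : C1 * u ^+ 2 * 4 =
        2 * 14 ^+ 4 * (16 * 56) * (4 * 56) ^+ 2 * 4 * (4 * 56 * u) ^+ 2.
      by rewrite C1E; ring.
    have := exprn_ege1 2 Ku_ge1; lra.
  - by case: (Xmin w).
  apply: (net_lower_bound _ L _ alpha (60 * sigma ^+ 2) (4 * N)) => //.
  - by rewrite mulr_gt0.
  - have : 0 <= u * N by exact: mulr_ge0 (ltW u0) N0.
    lra.
  - rewrite -uE; have := ler_wpM2r (ltW a20) L_ge.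
    have : 0 <= N * alpha ^+ 2 by exact: mulr_ge0 N0 (ltW a20).
    lra.
apply: (@le_trans _ _ (P (~` B))); last first.
  by apply: le_measure; rewrite ?inE//; exact: measurableC.
rewrite probability_setC// EFinB; apply: leeB => //; apply: (le_trans PB).
rewrite lee_fin; apply: (@le_trans _ _ (expR (2 * (L%:R * Lam)) *
  expR (- (m%:R * (alpha ^+ 2 / (16 * 56 * sigma ^+ 2)))))).
  by rewrite ler_wpM2r ?expR_ge0//; exact: net_cardinality_le.
rewrite -expRD ler_expR.
have -> : m%:R * (alpha ^+ 2 / (16 * 56 * sigma ^+ 2)) = m%:R / (16 * 56 * u).
  by rewrite -uE; field; rewrite !gt_eqF.
set v := 4 * 56 * u in Ku_ge1.
have NL0 : 0 <= u * (N * Lam).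
  exact: mulr_ge0 (ltW u0) (mulr_ge0 N0 Lam0).
(* The first summand pays for [C4 t^2], the second for the exponent [2 L Lam] of the net size; the
   powers of [v >= 1] are dropped next. *)
have m_div : 2 * 14 ^+ 4 * (4 * 56) ^+ 3 * t ^+ 2 * v + 2 * 14 ^+ 4 * (u * (N * Lam)) * v ^+ 4
    <= m%:R / (16 * 56 * u).
  rewrite ler_pdivlMr ?mulr_gt0//; apply: le_trans m_t.
  by rewrite C1E /v le_eqVlt; apply/orP; left; apply/eqP; ring.
have h1 : t ^+ 2 <= t ^+ 2 * v by rewrite ler_peMr ?sqr_ge0.
have h2 : u * (N * Lam) <= u * (N * Lam) * v ^+ 4 by rewrite ler_peMr ?exprn_ege1.
have h3 : L%:R * Lam <= 14 ^+ 4 * (u * (N * Lam)).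
  by have := ler_wpM2r Lam0 L_le; lra.
clearbody v; lra.
Qed.
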